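(* Let $\mathrm{PoF}_n$ denote the price of PROP1 with respect to egalitarian welfare for allocating contiguous blocks of chores to $n$ agents. Then $\mathrm{PoF}_3=2$, and $\mathrm{PoF}_n=\frac n2$ for every integer $n\ge 4$.
   Context: A fair-chores instance $\mathcal I=\langle N,E,\mathcal V\rangle$ consists of agents $N=\{1,\dots,n\}$, indivisible items $E=\{e_1,\dots,e_m\}$ placed on a path in this order, and for each agent $i$ an additive valuation $v_i$ (i.e. $v_i(S)=\sum_{e\in S}v_i(e)$) with $v_i(e)\le 0$ for all $e\in E$, normalized so that $v_i(\emptyset)=0$, $v_i(E)=-1$. A bundle is connected if it is a set of consecutive items (the empty set is allowed). An allocation $\mathbf A=(A_1,\dots,A_n)$ is a partition of $E$ into $n$ pairwise disjoint connected (possibly empty) bundles, $A_i$ being given to agent $i$ (the left-to-right order of the agents' bundles is arbitrary). Its egalitarian welfare is $\mathsf{EW}(\mathbf A)=\min_{i\in N}v_i(A_i)$; $\mathsf{OPT}_E(\mathcal I)$ is the maximum of $\mathsf{EW}$ over all allocations of $\mathcal I$. An allocation $\mathbf A$ is PROP1 (proportional up to one item) if for every $i\in N$, either $v_i(A_i)\ge\frac1n v_i(E)$, or there is an item $e\in A_i$ such that $A_i\setminus\{e\}$ is connected and $v_i(A_i\setminus\{e\})\ge\frac1n v_i(E)$. The price of fairness is $\mathrm{PoF}_n=\sup_{\mathcal I}\min_{\mathbf A}\frac{\mathsf{EW}(\mathbf A)}{\mathsf{OPT}_E(\mathcal I)}$, the supremum over all fair-chores instances with $n$ agents (any number of items)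 and the minimum over all PROP1 allocations $\mathbf A$ of $\mathcal I$; conventions: $c/0=+\infty$ for $c<0$ and $0/0=1$. *)

(* Defs.v *)
From HB Require Import structures.
From mathcomp Require Import all_boot all_order all_algebra.
From mathcomp Require Import all_classical all_reals ereal.

Set Implicit Arguments.
Unset Strict Implicit.
Unset Printing Implicit Defensive.

Import Order.TTheory GRing.Theory Num.Theory.

Local Open Scope ring_scope.

(* Agents are 'I_n; items are 'I_m, placed on the path in increasing order. *)

Section Chores.
Variables (R : realType) (n m : nat).

Definition bundle_value (v : 'I_n -> 'I_m -> R) (i : 'I_n) (S : {set 'I_m}) : R :=
  \sum_(e in S) v i e.

Definition fair_chores (v : 'I_n -> 'I_m -> R) : Prop :=
  (forall i e, v i e <= 0) /\ (forall i, bundle_value v i [set: 'I_m] = -1).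

(* The items a, ..., b - 1; b = m is allowed, and b <= a gives the empty set. *)
Definition connected_bundle (S : {set 'I_m}) : bool :=
  [exists a : 'I_m.+1, exists b : 'I_m.+1, S == [set e : 'I_m | (a <= e < b)%N]].

Definition allocation (A : {ffun 'I_n -> {set 'I_m}}) : bool :=
  [&& \bigcup_(i < n) A i == [set: 'I_m],
      [forall i, forall j, (i != j) ==> [disjoint A i & A j]]
    & [forall i, connected_bundle (A i)]].

(* Minimum and maximum of a finite family are taken in \bar R, so that the
   unit is neutral; the result is a real number when the family is nonempty. *)
Definition egal_welfare (v : 'I_n -> 'I_m -> R)
    (A : {ffun 'I_n -> {set 'I_m}}) : \bar R :=
  \big[mine/+oo%E]_(i < n) (bundle_value v i (A i))%:E.

Definition opt_egal (v : 'I_n -> 'I_m -> R) : \bar R :=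
  \big[maxe/-oo%E]_(A : {ffun 'I_n -> {set 'I_m}} | allocation A)
    egal_welfare v A.

Definition prop1 (v : 'I_n -> 'I_m -> R)
    (A : {ffun 'I_n -> {set 'I_m}}) : bool :=
  [forall i : 'I_n,
     (bundle_value v i (A i) >= n%:R^-1 * bundle_value v i [set: 'I_m]) ||
     [exists e in A i, connected_bundle (A i :\ e) &&
        (bundle_value v i (A i :\ e) >=
           n%:R^-1 * bundle_value v i [set: 'I_m])]].

(* The library's (0^-1)%E = +oo would give c / 0 = -oo for c < 0. *)
Definition welfare_ratio (c o : \bar R) : \bar R :=
  if o == 0%E then (if c == 0%E then 1%E else +oo%E) else (c / o)%E.

(* Equal to +oo if there is no PROP1 allocation. *)
Definition price_of_prop1_on (v : 'I_n -> 'I_m -> R) : \bar R :=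
  \big[mine/+oo%E]_(A : {ffun 'I_n -> {set 'I_m}} | allocation A && prop1 v A)
    welfare_ratio (egal_welfare v A) (opt_egal v).

End Chores.

Definition price_of_prop1 (R : realType) (n : nat) : \bar R :=
  ereal_sup [set x | exists (m : nat) (v : 'I_n -> 'I_m -> R),
                       fair_chores v /\ x = price_of_prop1_on v]%classic.

(* Main.v *)
(* Work with costs c = -v, q = 1/n and o = -OPT, and let x = max(2, n/2).

   Upper bound.  If o <= q, an optimal allocation is itself proportional.
   Otherwise T = x o satisfies T >= 1/2 and T >= 2q, and every item costs at most
   T to the agent who holds it in an optimal allocation; this is all that is
   needed to build a PROP1 allocation in which nobody pays more than T.  It is a
   moving-knife procedure: cut the shortest prefix that costs more than q to all
   agents and give it to an agent for whom it costs at most q without its last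
   item e.  If it costs more than T to all those agents, one of them gets the
   prefix without e; the remaining ones sit out until e is gone, after which
   little enough is left for them, since T >= 2q.  The procedure can only get
   stuck at an item which costs more than T to everyone still present.  So, as soon
   as an item k costs more than T to all remaining agents but one agent h, reserve
   k alone for h: no other item is that expensive for the others, and what is left
   on both sides of k is cheap enough for them to be divided without difficulty.

   Lower bound.  An agent is given items of cost 0 separated by items of cost
   slightly more than q, so that no PROP1 bundle contains both of the former,
   although an almost optimal allocation does so. *)

Require Import Defs.
From mathcomp Require Import all_boot all_order all_algebra.
From mathcomp Require Import all_classical all_reals ereal.
From mathcomp Require Import finset lra zify.

Set Implicit Arguments.
Unset Strict Implicit.
Unset Printing Implicit Defensive.

Import Order.TTheory GRing.Theory Num.Theory.

Local Open Scope ring_scope.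

(** * Dividing costs among agents with a moving knife *)

Section Division.

Context {R : realFieldType} {n m : nat}.
Variables (c : 'I_n -> 'I_m -> R) (q T : R) (i0 : 'I_n).
Hypothesis c_ge0 : forall i e, 0 <= c i e.
Hypothesis c_total : forall i, \sum_e c i e <= 1.
Hypothesis q_ge0 : 0 <= q.
Hypothesis T_ge_2q : 2 * q <= T.
Hypothesis T_ge_half : 1 <= 2 * T.

Definition block (a b : nat) : {set 'I_m} := [set e : 'I_m | (a <= e < b)%N].

Definition cost (i : 'I_n) (a b : nat) : R := \sum_(e in block a b) c i e.

Lemma cost_ge0 i a b : 0 <= cost i a b.
Proof. by apply: sumr_ge0 => e _. Qed.

Lemma cost_geq i a b : (b <= a)%N -> cost i a b = 0.
Proof.
move=> ba; rewrite /cost big_pred0// => e; rewrite inE.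
by apply/negbTE/negP => /andP[/(leq_trans ba)]; rewrite leqNgt => /negbTE ->.
Qed.

Lemma cost_cat i a b d : (a <= b <= d)%N -> cost i a d = cost i a b + cost i b d.
Proof.
move=> /andP[ab bd]; rewrite /cost (bigID (fun e : 'I_m => (e < b)%N))/=.
congr (_ + _); apply: eq_bigl => e; rewrite !inE.
  case: (ltnP e b) => eb; rewrite ?andbT ?andbF// (leq_trans eb bd) ?andbT//.
rewrite -leqNgt; case: (leqP b e) => be; rewrite ?andbT ?andbF//.
by rewrite (leq_trans ab be).
Qed.

Lemma cost_item i (e : 'I_m) : cost i e e.+1 = c i e.
Proof.
rewrite /cost (big_pred1 e)// => x; rewrite !inE ltnS -eqn_leq.
by rewrite eq_sym; apply/eqP/eqP => [|->//]; apply: val_inj.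
Qed.

Lemma le_cost i a b a' b' : (a' <= a)%N -> (b <= b')%N -> cost i a b <= cost i a' b'.
Proof.
move=> aa bb; have [ba|/ltnW ab] := leqP b a; first by rewrite cost_geq// cost_ge0.
rewrite (@cost_cat i a' a b') ?aa ?(leq_trans ab)// (@cost_cat i a b b') ?ab//.
by have := cost_ge0 i a' a; have := cost_ge0 i b b'; lra.
Qed.

Lemma cost_le1 i a b : cost i a b <= 1.
Proof.
apply: le_trans (c_total i); rewrite [leRHS](bigID (mem (block a b)))/=.
by rewrite lerDl sumr_ge0.
Qed.

Lemma cost_le_item i a b (e : 'I_m) : (a <= e < b)%N -> c i e <= cost i a b.
Proof. by move=> /andP[ae eb]; rewrite -cost_item le_cost. Qed.

(* Dropping the right end of the block, if any, must leave a cost at most q. *)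
Definition acceptable (i : 'I_n) (B : {set 'I_m}) : Prop :=
  exists a b : nat,
    [/\ (b <= m)%N, B = block a b, cost i a b <= T & cost i a b.-1 <= q].

(** An owner function makes the shares disjoint and covering at once. [D] need not be a block:
    reserving an item leaves one on each side of it. *)
Definition divides (D : {set 'I_m}) (S : {set 'I_n}) : Prop :=
  exists f : 'I_m -> 'I_n,
    (forall e, e \in D -> f e \in S) /\
    (forall i, i \in S -> acceptable i [set e in D | f e == i]).

Lemma acceptable_block i a b : (b <= m)%N ->
  cost i a b <= T -> cost i a b.-1 <= q -> acceptable i (block a b).
Proof. by move=> *; exists a, b. Qed.

Lemma acceptable_cheap i a b : (b <= m)%N -> cost i a b <= q -> acceptable i (block a b).
Proof.
move=> bm abq; apply: acceptable_block => //; first by move: abq T_ge_2q q_ge0; lra.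
by apply: le_trans abq; apply: le_cost => //; apply: leq_pred.
Qed.

Lemma acceptable_item i (e : 'I_m) : c i e <= T -> acceptable i (block e e.+1).
Proof.
move=> eT; apply: acceptable_block; first exact: ltn_ord.
  by rewrite cost_item.
by rewrite cost_geq.
Qed.

Lemma block_geq a b : (b <= a)%N -> block a b = set0.
Proof.
move=> ba; apply/setP => e; rewrite !inE; apply/negbTE/negP => /andP[].
by move=> /(leq_trans ba); rewrite leqNgt => /negbTE ->.
Qed.

Lemma block_cat a b d : (a <= b <= d)%N -> block a d = block a b :|: block b d.
Proof. by move=> abd; apply/setP => e; rewrite !inE; apply/idP/idP; lia. Qed.

Lemma disjoint_block a b a' b' : (b <= a')%N -> [disjoint block a b & block a' b'].
Proof.
move=> ba; rewrite -setI_eq0; apply/eqP/setP => e; rewrite !inE.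
by apply/negbTE/negP; lia.
Qed.

Lemma divides0 S : divides set0 S.
Proof.
exists (fun=> i0); split=> [e|i _]; first by rewrite inE.
have -> : [set e in set0 | i0 == i] = block 0 0 :> {set 'I_m}.
  by rewrite block_geq//; apply/setP => e; rewrite !inE.
by apply: acceptable_cheap; rewrite ?cost_geq.
Qed.

Lemma divides_add (B D : {set 'I_m}) (S : {set 'I_n}) j : j \in S ->
  [disjoint B & D] -> acceptable j B -> divides D (S :\ j) -> divides (B :|: D) S.
Proof.
move=> jS BD Bj [f [fS fD]].
have nD e : e \in B -> e \in D = false by move=> eB; apply: (disjointFr BD).
have fj e : e \in D -> f e == j = false.
  by move=> /fS; rewrite !inE => /andP[/negbTE].
exists (fun e => if e \in B then j else f e); split=> [e|i iS].
  by rewrite inE; case: ifP => //= _ /fS; rewrite inE => /andP[].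
have [->|ij] := eqVneq i j.
  suff -> : [set e in B :|: D | (if e \in B then j else f e) == j] = B by [].
  apply/setP => e; rewrite !inE; case: ifP => eB; rewrite ?eqxx//=.
  by case eD: (e \in D) => //=; rewrite fj.
suff -> : [set e in B :|: D | (if e \in B then j else f e) == i] = [set e in D | f e == i].
  by apply: fD; rewrite !inE ij.
apply/setP => e; rewrite !inE; case: ifP => eB //=.
by rewrite eq_sym (negbTE ij) nD.
Qed.

Lemma divides_block (S : {set 'I_n}) j a b : (a <= b <= m)%N -> j \in S ->
  acceptable j (block a b) -> divides (block b m) (S :\ j) -> divides (block a m) S.
Proof.
move=> abm jS acc div; rewrite (block_cat abm).
by apply: divides_add jS _ acc div; apply: disjoint_block.
Qed.

(** The shortest prefix costing more than [q] to all of [A] is nonempty since [q] is nonnegative;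
    [k] is its last item, and by minimality someone pays at most [q] without [k]. *)
Lemma last_cut (A : {set 'I_n}) a b : A != set0 ->
  (forall i, i \in A -> q < cost i a b) ->
  exists2 k, (a <= k < b)%N &
    (forall i, i \in A -> q < cost i a k.+1) /\
    exists2 j, j \in A & cost j a k <= q.
Proof.
move=> /set0Pn[x xA] Aq.
pose P p := [forall i in A, q < cost i a p].
have exP : exists p, P p by exists b; apply/forall_inP.
case: (ex_minnP exP) => p /forall_inP Pp pmin.
have pb : (p <= b)%N by apply: pmin; apply/forall_inP.
have ap : (a < p)%N.
  rewrite ltnNge; apply/negP => pa; have := Pp _ xA.
  by rewrite cost_geq// ltNge q_ge0.
case: p ap pb Pp pmin => // p ap pb Pp pmin; exists p; first by rewrite -ltnS ap.
split=> //; have : ~~ P p by apply/negP => /pmin; rewrite ltnn.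
by move=> /forall_inPn[j jA]; rewrite -leNgt => ?; exists j.
Qed.

(** Item [k] is reserved for an agent outside [S]. A cut on the left of [k] costs its taker at most
    T, as the whole left side does, and the others more than [q]. Once the left side is worth at
    most [q] to someone, that agent takes all of it. The premise on subsets [S'] is to be filled by
    the induction hypothesis of [divides_suffix]. *)
Lemma divides_around (k : 'I_m) (S : {set 'I_n}) a : (a <= k)%N ->
  (forall i, i \in S -> cost i a k <= T) ->
  (forall i, i \in S -> cost i a k + cost i k.+1 m < (#|S|%:R - 1) * q) ->
  (forall S' : {set 'I_n}, S' != set0 -> S' \subset S ->
     (forall i, i \in S' -> cost i k.+1 m <= #|S'|%:R * q) -> divides (block k.+1 m) S') ->
  S != set0 -> divides (block a k :|: block k.+1 m) S.
Proof.
have [s] := ubnP #|S|; elim: s S a => // s IH S a sS ak ST Sq rest S0.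
(* For a single agent the strict bound would make a cost negative, so somebody is always left for
   the right side. *)
have big : forall j, j \in S -> S :\ j != set0.
  move=> j jS; rewrite -card_gt0 lt0n; apply/eqP => S1.
  have := Sq _ jS; rewrite (cardsD1 j) jS S1 /= subrr mul0r.
  by have := cost_ge0 j a k; have := cost_ge0 j k.+1 m; lra.
have card : forall j, j \in S -> #|S|%:R = #|S :\ j|%:R + 1 :> R.
  by move=> j jS; rewrite (cardsD1 j) jS natr1.
case: (pickP [pred i in S | cost i a k <= q]) => [j /= /andP[jS jq]|none].
  apply: (divides_add jS); first exact: disjoint_block.
    by apply: acceptable_cheap => //; apply: ltnW.
  apply: rest; [exact: big|exact: subD1set|move=> i; rewrite inE => /andP[_ iS]].
  by have := Sq _ iS; rewrite (card _ jS); have := cost_ge0 i a k; lra.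
have [i iS|p /andP[ap pk] [Sp [j jS jp]]] := last_cut (b := k) (a := a) S0.
  by have := none i; rewrite /= iS/= => /negbT; rewrite -ltNge.
rewrite (@block_cat a p.+1 k) ?(leqW ap)// -setUA; apply: (divides_add jS).
- rewrite -setI_eq0 setIUr setU_eq0 !setI_eq0 !disjoint_block//.
  by apply: ltnW; rewrite ltnS.
- apply: acceptable_block; rewrite ?(leq_trans pk) ?(ltnW (ltn_ord k))//.
  by apply: le_trans (ST _ jS); apply: le_cost.
apply: IH => //; last exact: big.
- by move: sS; rewrite (cardsD1 j) jS.
- by move=> i; rewrite inE => /andP[_ iS]; apply: le_trans (ST _ iS); apply: le_cost; rewrite ?(leqW ap).
- move=> i; rewrite inE => /andP[_ iS]; have := Sq _ iS; have := Sp _ iS.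
  by rewrite (card _ jS) (@cost_cat i a p.+1 k) ?(leqW ap)//; lra.
- move=> S' S'0 S'S; apply: rest => //; exact: fintype.subset_trans S'S (subD1set _ _).
Qed.

Lemma two_items_le1 i (e k : 'I_m) : e != k -> c i e + c i k <= 1.
Proof.
move=> ek; apply: le_trans (c_total i); rewrite (bigD1 e)//= (bigD1 k)/=; last by rewrite eq_sym.
by rewrite addrA lerDl sumr_ge0.
Qed.

(* The second alternative describes the agents waiting for item a to be taken:
   when they joined that group, the items up to a cost them more than T, which is
   the price of two shares and more than half of everything. *)
Lemma divides_suffix (S : {set 'I_n}) a : (a <= m)%N ->
  (forall e : 'I_m, (a <= e)%N -> exists2 i, i \in S & c i e <= T) ->
  (forall i, i \in S -> cost i a m <= #|S|%:R * q \/
     (cost i a.+1 m < (#|S|%:R - 1) * q /\ forall e : 'I_m, (a < e)%N -> c i e <= T)) ->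
  divides (block a m) S.
Proof.
have [s] := ubnP #|S|; elim: s S a => // s IH S a sS am nf inv.
have [ma|ltam] := leqP m a; first by rewrite block_geq//; apply: divides0.
pose f := Ordinal ltam.
have costf i : cost i a m = c i f + cost i a.+1 m.
  by rewrite (@cost_cat i a a.+1 m) ?leqnSn// -(cost_item i f).
case: (pickP [pred i in S | cost i a m <= q]) => [j /= /andP[jS jq]|none].
  rewrite -[block a m]setU0; apply: (divides_add jS _ _ (divides0 _)).
    by rewrite -setI_eq0 setI0.
  exact: acceptable_cheap.
have big i : i \in S -> q < cost i a m.
  by move=> iS; have := none i; rewrite /= iS/= => /negbT; rewrite -ltNge.
have card j : j \in S -> #|S|%:R = #|S :\ j|%:R + 1 :> R.
  by move=> jS; rewrite (cardsD1 j) jS natr1.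
(* A lone agent would satisfy neither alternative: the first contradicts [big], the second a
   nonnegative cost. *)
have S2 j : j \in S -> S :\ j != set0.
  move=> jS; rewrite -card_gt0 lt0n; apply/eqP => S1.
  have := big _ jS; have := inv _ jS; rewrite (card _ jS) S1.
  by move: (cost_ge0 j a.+1 m) => ?; case=> [?|[? _]]; lra.
have give j b : j \in S -> (a < b <= m)%N -> acceptable j (block a b) ->
    (forall e : 'I_m, (b <= e)%N -> exists2 i, i \in S :\ j & c i e <= T) ->
    (forall i, i \in S -> i != j -> cost i b m <= (#|S|%:R - 1) * q \/
     (cost i b.+1 m < (#|S|%:R - 2) * q /\ forall e : 'I_m, (b < e)%N -> c i e <= T)) ->
    divides (block a m) S.
  move=> jS /andP[ab bm] acc nfb invb; apply: (@divides_block _ j _ b) => //.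
    by rewrite (ltnW ab).
  apply: IH => //; first by move: sS; rewrite (cardsD1 j) jS.
  move=> i; rewrite !inE => /andP[ij iS]; have := invb _ iS ij; rewrite (card _ jS).
  by case=> [?|[? ?]]; [left; lra|right; split=> //; lra].
case: (boolP [exists h in S, exists k : 'I_m,
    (a <= k)%N && [forall i in S :\ h, T < c i k]]); last first.
  move=> /exists_inPn nK.
  (* In this case any agent may leave, and each item still has a possible taker. *)
  have nf1 h (k : 'I_m) : h \in S -> (a <= k)%N -> exists2 i, i \in S :\ h & c i k <= T.
    move=> hS ak; have := nK _ hS; rewrite negb_exists => /forallP/(_ k); rewrite ak/= => /forall_inPn[i iS].
    by rewrite -leNgt; exists i.
  (* The agents outside [A] are waiting for item [a] to go. *)
  pose A := [set i in S | cost i a m <= #|S|%:R * q].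
  have AS i : i \in A -> i \in S by rewrite inE => /andP[].
  have Aq i : i \in A -> cost i a m <= #|S|%:R * q by rewrite inE => /andP[].
  have notA i : i \in S -> i \notin A -> cost i a.+1 m < (#|S|%:R - 1) * q.
    by move=> iS; rewrite inE iS/=; case: (inv _ iS) => [->//|[]].
  (* Item [a] alone goes to somebody who can bear it: agents of [A] are relieved of more than T, and
     the waiting ones become active again. *)
  have single : (forall i, i \in A -> T < c i f) -> divides (block a m) S.
    move=> Af; have [j jS jf] := nf f (leqnn _).
    apply: (give j a.+1 jS) => //; rewrite ?ltnSn//.
    - exact: (acceptable_item jf).
    - by move=> e ae; apply: nf1 => //; apply: ltnW.
    move=> i iS ij; left; have [iA|iA] := boolP (i \in A); last exact: ltW (notA _ iS iA).
    by have := Af _ iA; have := Aq _ iA; rewrite costf; move: T_ge_2q q_ge0; lra.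
  have [A0|A0] := eqVneq A set0; first by apply: single => i; rewrite A0 inE.
  have [i /AS/big//|k /andP[ak km] [Ak [j jA jk]]] := last_cut (b := m) (a := a) A0.
  case: (pickP [pred x in A | (cost x a k <= q) && (cost x a k.+1 <= T)]).
    move=> x /= /and3P[xA xk xT]; apply: (give x k.+1 (AS _ xA)); rewrite ?ltnS ?ak//.
    - exact: acceptable_block.
    - by move=> e ke; apply: nf1; [exact: AS|apply: leq_trans ke; apply: leqW].
    move=> i iS ix; left; have [iA|iA] := boolP (i \in A).
      have := Aq _ iA; have := Ak _ iA.
      by rewrite (@cost_cat i a k.+1 m) ?km ?(leqW ak)//; lra.
    by apply: le_trans (ltW (notA _ iS iA)); apply: le_cost.
  move=> none'.
  have blocked i : i \in A -> cost i a k <= q -> T < cost i a k.+1.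
    by move=> iA ik; have := none' i; rewrite /= iA ik/= => /negbT; rewrite -ltNge.
  have [ka|ka] := eqVneq k a.
    apply: single => i iA; rewrite -(cost_item i f)/= -{2}ka; apply: blocked => //.
    by rewrite ka cost_geq.
  have {ka}ak : (a < k)%N by rewrite ltn_neqAle eq_sym ka.
  (* Nobody can take the prefix with [k], so [j] takes it without [k]. As [a < k], item [a] is gone
     and the former waiting agents are active again. *)
  apply: (give j k (AS _ jA)); rewrite ?ak ?(ltnW km)//.
  - by apply: acceptable_cheap => //; apply: ltnW.
  - by move=> e ke; apply: nf1; [exact: AS|apply: leq_trans ke; apply: ltnW].
  move=> i iS ij; have [iA|iA] := boolP (i \in A); last first.
    by left; apply: le_trans (ltW (notA _ iS iA)); apply: le_cost.
  have [iq|iq] := leP (cost i a k) q; last first.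
    left; have := Aq _ iA; rewrite (@cost_cat i a k m) ?(ltnW ak) ?(ltnW km)//.
    by move: iq; lra.
  (* Agent [i] starts waiting for [k]: the items up to [k] cost it more than T, hence two shares,
     and leave at most [1 - T <= T] for any later item. *)
  right; have iT := blocked _ iA iq; split.
    have := Aq _ iA; rewrite (@cost_cat i a k.+1 m) ?km ?(leqW (ltnW ak))//.
    by move: iT T_ge_2q; lra.
  move=> e ke; have := cost_le1 i a m.
  rewrite (@cost_cat i a k.+1 m) ?km ?(leqW (ltnW ak))//.
  have : c i e <= cost i k.+1 m by apply: cost_le_item; rewrite ke/=.
  by move: iT T_ge_half; lra.
move=> /exists_inP[h hS /existsP[k /andP[ak /forall_inP K]]].
have hk : c h k <= T.
  have [i iS ik] := nf _ ak; have [<-//|ih] := eqVneq i h.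
  by have := K i; rewrite !inE ih iS ltNge ik => /(_ isT).
(* Two items costing more than T each would exceed the total of 1. *)
have uniq_bad i e : i \in S :\ h -> e != k -> c i e <= T.
  move=> /K ik ek; have := two_items_le1 i ek.
  by move: ik T_ge_half; lra.
have [x xSh] := set0Pn _ (S2 _ hS).
have [kf|kf] := eqVneq k f.
  subst k; apply: (give h a.+1 hS); rewrite ?ltnSn//.
  - exact: (acceptable_item hk).
  - move=> e ae; exists x => //; apply: uniq_bad => //.
    by apply/eqP => ef; move: ae; rewrite ef ltnn.
  move=> i iS ih; left; have := K i; rewrite !inE ih iS => /(_ isT) iT.
  have := inv _ iS; rewrite costf.
  by move: T_ge_2q q_ge0 iT => ? ? ?; case=> [?|[? _]]; lra.
have {}ak : (a < k)%N.
  by rewrite ltn_neqAle ak andbT; apply: contra_neq kf => ak'; apply: val_inj.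
have akm : (a <= k <= m)%N by rewrite (ltnW ak) ltnW.
have cut i : cost i a m = cost i a k + c i k + cost i k.+1 m.
  rewrite (@cost_cat i a k m)// (@cost_cat i k k.+1 m) ?leqnSn ?ltn_ord//.
  by rewrite cost_item addrA.
have -> : block a m = block k k.+1 :|: (block a k :|: block k.+1 m).
  by rewrite setUCA -(@block_cat k k.+1 m) ?leqnSn ?ltn_ord// -block_cat.
apply: (divides_add hS); [|exact: acceptable_item|].
  rewrite disjoint_sym -setI_eq0 setIUl setU_eq0 !setI_eq0 disjoint_block//.
  by rewrite disjoint_sym disjoint_block.
apply: divides_around => //; [exact: ltnW| | | |exact: S2].
- move=> i /K iT; have := cost_le1 i a m; rewrite cut.
  by have := cost_ge0 i k.+1 m; move: T_ge_half iT; lra.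
(* No agent but [h] can be waiting, since [k] lies after [a] and costs more than T. Removing [k]
   then saves two shares, one of them for [h]. *)
- move=> i iSh; have iT := K _ iSh; move: iSh; rewrite !inE => /andP[_ /inv].
  case=> [|[_ /(_ _ ak)]]; last by rewrite leNgt iT.
  by rewrite cut (card _ hS); move: T_ge_2q iT; lra.
move=> S' S'0 S'S S'q; apply: IH.
- by apply: leq_ltn_trans (subset_leq_card S'S) _; move: sS; rewrite (cardsD1 h) hS.
- exact: ltn_ord.
- move=> e ke; have [y yS'] := set0Pn _ S'0; exists y => //.
  apply: uniq_bad; first exact: (fintype.subsetP S'S).
  by apply/eqP => ek; move: ke; rewrite ek ltnn.
by move=> i iS'; left; apply: S'q.
Qed.

End Division.

(** * From divisions to PROP1 allocations *)

Section Allocations.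

Context {R : realType} {n m : nat}.
Implicit Types (v : 'I_n -> 'I_m -> R) (A : {ffun 'I_n -> {set 'I_m}}).

Lemma connected_block a b : (b <= m)%N -> connected_bundle (@block m a b).
Proof.
(* The left end is capped at [m] because [a] may lie beyond the path; the block is then empty. *)
move=> bm; apply/existsP; exists (inord (minn a m)); apply/existsP; exists (inord b).
apply/eqP/setP => e; rewrite !inE !inordK ?ltnS ?geq_minr//.
by have := ltn_ord e; lia.
Qed.

Lemma connected_convex (B : {set 'I_m}) (x y z : 'I_m) : connected_bundle B ->
  (x <= y <= z)%N -> x \in B -> z \in B -> y \in B.
Proof.
by move=> /existsP[a /existsP[b /eqP ->]]; rewrite !inE; lia.
Qed.

Lemma allocation_of_owner (f : 'I_m -> 'I_n) :
  (forall i, connected_bundle [set e | f e == i]) ->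
  allocation [ffun i => [set e | f e == i]].
Proof.
move=> fconn; apply/and3P; split.
- apply/eqP/setP => e; rewrite inE; apply/bigcupP; exists (f e) => //.
  by rewrite ffunE inE.
- apply/forallP => i; apply/forallP => j; apply/implyP => ij; rewrite !ffunE.
  rewrite -setI_eq0; apply/eqP/setP => e; rewrite !inE; apply/negbTE/negP.
  by move=> /andP[/eqP-> /eqP ji]; rewrite ji eqxx in ij.
- by apply/forallP => i; rewrite ffunE.
Qed.

Lemma allocation_owner A e : allocation A -> exists i, e \in A i.
Proof.
move=> /and3P[/eqP cov _ _]; have : e \in [set: 'I_m] by rewrite inE.
by rewrite -cov => /bigcupP[i _ ?]; exists i.
Qed.

Lemma allocation_uniq A i j e : allocation A -> e \in A i -> e \in A j -> i = j.
Proof.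
move=> /and3P[_ /forallP dis _] ei ej; apply/eqP; apply: contraTT ej => ij.
by have := dis i => /forallP/(_ j); rewrite ij => /disjointFr ->.
Qed.

Lemma allocation_connected A i : allocation A -> connected_bundle (A i).
Proof. by move=> /and3P[_ _ /forallP]. Qed.

Lemma fair_prop1_allocation v (T : R) : (0 < n)%N -> fair_chores v ->
  1 <= 2 * T -> 2 * n%:R^-1 <= T -> (forall e, exists i, - T <= v i e) ->
  exists A, [/\ allocation A, prop1 v A & forall i, - T <= bundle_value v i (A i)].
Proof.
move=> n0 [v_le0 v_total] T1 T2 vT.
pose c i e := - v i e.
have valueE i S : bundle_value v i S = - \sum_(e in S) c i e.
  by rewrite sumrN opprK.
have [||||||||f [_ fP]] := @divides_suffix R n m c n%:R^-1 T (Ordinal n0) _ _ _ _ _ setT 0.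
- by move=> i e; rewrite oppr_ge0.
- move=> i; have := v_total i; rewrite valueE => /eqP; rewrite eqr_opp => /eqP.
  by under eq_bigl do rewrite inE; move=> ->.
- by rewrite invr_ge0.
- exact: T2.
- exact: T1.
- by [].
- by move=> e _; have [i iT] := vT e; exists i; rewrite ?inE// lerNl.
- move=> i _; left; rewrite cardsT card_ord mulfV ?pnatr_eq0 -?lt0n//.
  have := v_total i; rewrite valueE => /eqP; rewrite eqr_opp => /eqP <-.
  rewrite le_eqVlt; apply/orP; left; apply/eqP; apply: eq_bigl => e.
  by rewrite !inE ltn_ord.
have fB i : [set e in block 0 m | f e == i] = [set e | f e == i].
  by apply/setP => e; rewrite !inE ltn_ord.
have acc i : acceptable c n%:R^-1 T i [set e | f e == i].
  by rewrite -fB; apply: fP; rewrite inE.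
exists [ffun i => [set e | f e == i]]; split.
- apply: (allocation_of_owner (f := f)) => i; have [a [b [bm -> _ _]]] := acc i.
  exact: connected_block.
- apply/forallP => i; rewrite ffunE; have [a [b [bm -> _ abq]]] := acc i.
  rewrite v_total mulrN1 !valueE lerN2.
  have [ba|ab] := leqP b a.
    by rewrite block_geq// big_set0 invr_ge0 ler0n.
  apply/orP; right; apply/exists_inP.
  case: b ab bm abq => // b ab bm abq; exists (Ordinal bm).
    by rewrite inE /= -ltnS ab ltnSn.
  have -> : block a b.+1 :\ Ordinal bm = block a b.
    by apply/setP => e; rewrite !inE -(inj_eq val_inj)/=; lia.
  by rewrite valueE lerN2 connected_block// ltnW.
- move=> i; rewrite ffunE valueE lerN2; have [a [b [_ -> abT _]]] := acc i.
  exact: abT.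
Qed.

Lemma bundle_value_le0 v i S : fair_chores v -> bundle_value v i S <= 0.
Proof. by move=> [v0 _]; apply: sumr_le0. Qed.

Lemma bundle_value_le1 v i e (S : {set 'I_m}) : fair_chores v -> e \in S ->
  bundle_value v i S <= v i e.
Proof.
by move=> [v0 _] eS; rewrite /bundle_value (bigD1 e)//= gerDl sumr_le0.
Qed.

Lemma bundle_value_le2 v i (x y : 'I_m) (S : {set 'I_m}) : fair_chores v ->
  x != y -> x \in S -> y \in S -> bundle_value v i S <= v i x + v i y.
Proof.
move=> [v0 _] xy xS yS; rewrite /bundle_value (bigD1 x)//= lerD2l.
by rewrite (bigD1 y) ?yS 1?eq_sym//= gerDl sumr_le0.
Qed.

(* The middle item y cannot be dropped without disconnecting the bundle. *)
Lemma prop1_sandwich v A i (x y z : 'I_m) : fair_chores v -> allocation A ->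
  prop1 v A -> (x < y < z)%N -> x \in A i -> z \in A i ->
  v i x + v i y < - n%:R^-1 -> v i y + v i z < - n%:R^-1 -> False.
Proof.
move=> vf alA /forallP/(_ i); rewrite vf.2 mulrN1 => Ai /andP[xy yz] xA zA xyn yzn.
have yA : y \in A i.
  by apply: connected_convex (allocation_connected i alA) _ xA zA; rewrite (ltnW xy) ltnW.
have neq (s t : 'I_m) : (s < t)%N -> s != t.
  by move=> st; apply/eqP => ts; rewrite ts ltnn in st.
case/orP: Ai => [|/exists_inP[e eA /andP[conn]]].
  by have := bundle_value_le2 i vf (neq _ _ xy) xA yA; move: xyn; lra.
have mem (t : 'I_m) : t \in A i -> e != t -> t \in A i :\ e.
  by move=> tA et; rewrite !inE eq_sym et.
have [ey|ey] := eqVneq e y.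
  have : y \in A i :\ e.
    have ex : e != x by rewrite ey eq_sym neq.
    have ez : e != z by rewrite ey neq.
    apply: connected_convex conn _ (mem x xA ex) (mem z zA ez).
    by rewrite (ltnW xy) ltnW.
  by rewrite ey !inE eqxx.
have [ex|ex] := eqVneq e x.
  have := bundle_value_le2 i vf (neq _ _ yz) (mem y yA ey) (mem z zA _).
  by rewrite ex neq ?(ltn_trans xy yz)// => /(_ isT); move: yzn; lra.
by have := bundle_value_le2 i vf (neq _ _ xy) (mem x xA ex) (mem y yA ey); move: xyn; lra.
Qed.

(** * Egalitarian welfare and bounds on the price *)

Lemma le_egal_welfare v A (x : R) :
  (forall i, x <= bundle_value v i (A i)) -> (x%:E <= egal_welfare v A)%E.
Proof.
by move=> xA; apply/bigmin_geP; split=> [|i _]; [exact: leey|rewrite lee_fin].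
Qed.

Lemma egal_welfare_le v A i : (egal_welfare v A <= (bundle_value v i (A i))%:E)%E.
Proof. exact: (bigmin_le_cond +oo%E (j := i)). Qed.

Lemma egal_welfareE v A : (0 < n)%N ->
  exists i, egal_welfare v A = (bundle_value v i (A i))%:E.
Proof.
move=> n0; have [i _] := eq_bigmin (x := +oo%E) (Ordinal n0) predT
  (fun i => (bundle_value v i (A i))%:E) isT (fun i _ => leey _).
by exists i.
Qed.

Lemma opt_egalE v : (0 < n)%N ->
  exists2 A, allocation A & opt_egal v = egal_welfare v A.
Proof.
(* Giving everything to one agent shows that the maximum is over a nonempty family, so it is
   attained. *)
move=> n0; pose f (e : 'I_m) := Ordinal n0.
have fA : allocation [ffun i => [set e | f e == i]].
  apply: (allocation_of_owner (f := f)) => i.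
  have -> : [set e | f e == i] = if i == Ordinal n0 then block 0 m else block 0 0.
    by apply/setP => e; rewrite inE /f eq_sym; case: ifP; rewrite !inE// ltn_ord.
  by case: ifP => _; apply: connected_block.
have [A AA eqA] := eq_bigmax (x := -oo%E) _ _ (egal_welfare v) fA (fun i _ => leNye _).
by exists A.
Qed.

Lemma price_le v (r : R) : (3 <= n)%N -> fair_chores v -> 2 <= r -> n%:R / 2 <= r ->
  (price_of_prop1_on v <= r%:E)%E.
Proof.
move=> n3 vf r2 nr; have n0 : (0 < n)%N by apply: leq_trans n3.
have nR : 0 < n%:R :> R by rewrite ltr0n.
have [A alA optA] := opt_egalE v n0; have [i1 welA] := egal_welfareE v A n0.
have o0 := bundle_value_le0 i1 (A i1) vf.
have Ao i : bundle_value v i1 (A i1) <= bundle_value v i (A i).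
  by rewrite -lee_fin -welA egal_welfare_le.
rewrite /price_of_prop1_on optA welA; set o := bundle_value v i1 (A i1) in o0 Ao welA *.
have [on|on] := leP (- n%:R^-1) o.
  apply: (bigmin_inf A).
    rewrite alA; apply/forallP => i; rewrite vf.2 mulrN1.
    by rewrite (le_trans on (Ao i)).
  rewrite /welfare_ratio welA; case: ifPn => o1; first by rewrite ?o1 lee_fin; move: r2; lra.
  by rewrite divee// lee_fin; move: r2; lra.
have no : 1 < n%:R * - o.
  by rewrite -ltr_pdivrMl// mulr1 ltrNr.
(* Since the optimum is below [-1/n], [n/2 <= r] gives T at least 1/2 and [2 <= r] gives T at least
   [2/n]. *)
have [] := @fair_prop1_allocation v (r * - o) n0 vf.
- have : n%:R / 2 * - o <= r * - o by rewrite ler_wpM2r// oppr_ge0.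
  by move: no; lra.
- have : 2 * - o <= r * - o by rewrite ler_wpM2r// oppr_ge0.
  by move: on; lra.
- move=> e; have [i ei] := allocation_owner e alA; exists i.
  have : 1 * - o <= r * - o by rewrite ler_wpM2r ?oppr_ge0//; move: r2; lra.
  by have := bundle_value_le1 i vf ei; have := Ao i; lra.
move=> B [alB pB BT]; apply: (bigmin_inf B); first by rewrite alB.
have oneg : o < 0 by apply: lt_trans on _; rewrite oppr_lt0 invr_gt0.
rewrite /welfare_ratio eqe lt_eqF//; have [j ->] := egal_welfareE v B n0.
rewrite inver lt_eqF// -EFinM lee_fin ler_ndivrMr//.
by have := BT j; rewrite mulrN opprK.
Qed.

(** Every PROP1 welfare is at most [b], hence at most [r] times the optimum; dividing by a negative
    optimum reverses the inequality. For optimum 0, [b < 0] makes the ratio infinite. *)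
Lemma le_price v (r b o : R) : (0 < n)%N -> fair_chores v -> 0 <= r -> b < 0 -> b <= r * o ->
  (exists2 A, allocation A & forall i, o <= bundle_value v i (A i)) ->
  (forall A, allocation A -> prop1 v A -> exists i, bundle_value v i (A i) <= b) ->
  (r%:E <= price_of_prop1_on v)%E.
Proof.
move=> n0 vf r0 b0 bro [A0 alA0 A0o] bad; apply/bigmin_geP; split=> [|A /andP[alA pA]].
  exact: leey.
have [A1 _ optA] := opt_egalE v n0; have [i1 welA] := egal_welfareE v A1 n0.
have o1 := bundle_value_le0 i1 (A1 i1) vf.
have : (o%:E <= opt_egal v)%E.
  apply: le_trans (le_egal_welfare A0o) _.
  exact: (le_bigmax_cond -oo%E (j := A0)).
rewrite optA welA lee_fin => oo1.
have [i Aib] := bad A alA pA; have [j Aj] := egal_welfareE v A n0.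
have : (egal_welfare v A <= b%:E)%E.
  by apply: le_trans (egal_welfare_le v A i) _; rewrite lee_fin.
rewrite Aj lee_fin => jb; rewrite /welfare_ratio !eqe; case: ifPn => [_|o1n0].
  by rewrite lt_eqF ?leey//; apply: le_lt_trans b0.
have {o1n0}o1 : bundle_value v i1 (A1 i1) < 0 by rewrite lt_neqAle o1n0.
rewrite inver lt_eqF// -EFinM lee_fin ler_ndivlMr//.
apply: le_trans jb (le_trans bro _); exact: ler_wpM2l.
Qed.

End Allocations.

(** The instances below approach their bound, so each smaller [r] is treated separately; [1 <= r]
    keeps their parameters in range. *)
Lemma ereal_le_of_lt (R : realType) (x : R) (S : \bar R) : 1 < x ->
  (forall r, 1 <= r < x -> (r%:E <= S)%E) -> (x%:E <= S)%E.
Proof.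
move=> x1 rS; have S1 : (1%:E <= S)%E by apply: rS; rewrite lexx.
rewrite leNgt; apply/negP; case: S rS S1 => [s| |]// rS; rewrite !lee_fin lte_fin => s1 sx.
have : (((s + x) / 2)%:E <= s%:E)%E by apply: rS; lra.
by rewrite lee_fin; lra.
Qed.

(** * Two families of bad instances *)

Section LowerBounds.

Context {R : realType}.

(* With u slightly above 1/n: agent 0 could take the first three items at cost u,
   but not in a PROP1 allocation, so another agent pays 1/2. *)
Definition chores_four (u : R) (n : nat) (i : 'I_n.+2) (e : 'I_4) : R :=
  nth 0 (if i == ord0 then [:: 0; - u; 0; u - 1] else [:: - (1 / 2); 0; - (1 / 2); 0]) e.

Lemma chores_four_fair (u : R) n : 0 <= u <= 1 -> fair_chores (@chores_four u n).
Proof.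
move=> u01; split=> [i [[|[|[|[|//]]]] ?]|i]; rewrite /chores_four.
1-4: by case: ifP => _ /=; lra.
rewrite /bundle_value big_mkcond !big_ord_recl big_ord0 !inE /=.
by case: ifP => _ /=; lra.
Qed.

Lemma price_chores_four (u : R) n : n.+2%:R^-1 < u <= 1 ->
  ((1 / (2 * u))%:E <= price_of_prop1_on (@chores_four u n))%E.
Proof.
move=> /andP[un u1]; have u0 : 0 < u by apply: lt_trans un; rewrite invr_gt0.
have vf : fair_chores (@chores_four u n) by apply: chores_four_fair; rewrite u1 ltW.
apply: (@le_price _ _ _ _ _ (- (1 / 2)) (- u)) => //.
- by rewrite divr_ge0// mulr_ge0// ltW.
- by rewrite mulrN lerN2 !div1r invfM -mulrA mulVf ?gt_eqF// mulr1.
(* Agent 0 pays [u] for the first three items, and agent 1 takes the last one for free. *)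
- pose f (e : 'I_4) : 'I_n.+2 := if (e < 3)%N then ord0 else lift ord0 ord0.
  have fE i : [set e | f e == i] = if i == ord0 then block 0 3
      else if i == lift ord0 ord0 then block 3 4 else block 0 0.
    apply/setP => e; rewrite inE /f; case: (ltnP e 3) => e3.
      rewrite eq_sym; case: eqVneq => _; first by rewrite inE e3.
      by case: ifP => _; rewrite !inE// ltnNge -ltnS e3.
    have [->|i0] := eqVneq i ord0; first by rewrite inE ltnNge e3.
    by rewrite eq_sym; case: ifP => _; rewrite !inE// e3 ltn_ord.
  exists [ffun i => [set e | f e == i]].
    apply: (allocation_of_owner (f := f)) => i; rewrite fE.
    by case: ifP => _; [|case: ifP => _]; apply: connected_block.
  move=> i; rewrite ffunE fE /bundle_value /chores_four big_mkcond.
  rewrite !big_ord_recl big_ord0.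
  by case: (i == ord0); [|case: (i == _)]; rewrite !inE /=; lra.
move=> A alA pA.
pose x := @Ordinal 4 0 isT; pose y := @Ordinal 4 1 isT; pose z := @Ordinal 4 2 isT.
have other e i : e \in A i -> i != ord0 -> (e == x) || (e == z) ->
    exists j, bundle_value (@chores_four u n) j (A j) <= - (1 / 2).
  move=> eA i0 exz; exists i; apply: le_trans (bundle_value_le1 i vf eA) _.
  by case/orP: exz => /eqP ->; rewrite /chores_four (negbTE i0)/=.
have [i xA] := allocation_owner x alA; have [k zA] := allocation_owner z alA.
have [i0|i0] := eqVneq i ord0; last by apply: other xA i0 _; rewrite eqxx.
have [k0|k0] := eqVneq k ord0; last by apply: other zA k0 _; rewrite eqxx orbT.
subst i k; exfalso; apply: (prop1_sandwich (y := y) vf alA pA _ xA zA) => //.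
all: by rewrite /chores_four/= ?sub0r ?addr0 ltrN2.
Qed.

(* Agent 0 could take items 2 to 4 at cost 1/3 + d.  In a PROP1 allocation in which
   agent 0 takes item 4, however, it gets neither item 2 nor item 6, so that one
   of the other agents holds items 0, 1 and 2, which violates PROP1. *)
Definition chores_seven (d : R) (i : 'I_3) (e : 'I_7) : R :=
  nth 0 (if i == ord0 then [:: 0; 0; 0; - (1 / 3 + d); 0; d - 2 / 3; 0]
         else [:: - d; - (1 / 3); - d; 0; 2 * d - 2 / 3; 0; 0]) e.

Lemma chores_seven_fair (d : R) : 0 <= d <= 1 / 3 -> fair_chores (chores_seven d).
Proof.
move=> d01; split=> [i [[|[|[|[|[|[|[|//]]]]]]] ?]|i]; rewrite /chores_seven.
1-7: by case: ifP => _ /=; lra.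
rewrite /bundle_value big_mkcond !big_ord_recl big_ord0 !inE /=.
by case: ifP => _ /=; lra.
Qed.

Lemma price_chores_seven (d : R) : 0 < d -> d < 1 / 3 ->
  (((2 / 3 - 2 * d) / (1 / 3 + d))%:E <= price_of_prop1_on (chores_seven d))%E.
Proof.
move=> d0 d3; have vf : fair_chores (chores_seven d) by apply: chores_seven_fair; apply/andP; split; lra.
apply: (@le_price _ _ _ _ _ (2 * d - 2 / 3) (- (1 / 3 + d))) => //; [|lra| | |].
- by rewrite divr_ge0//; lra.
- by rewrite mulrN mulfVK ?gt_eqF; lra.
(* Agents 0 and 1 pay [1 / 3 + d] each, agent 2 nothing. *)
- pose f (e : 'I_7) : 'I_3 := if (e < 2)%N then @Ordinal 3 1 isT
    else if (e < 5)%N then ord0 else @Ordinal 3 2 isT.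
  have fE i : [set e | f e == i] = nth set0 [:: block 2 5; block 0 2; block 5 7] i.
    apply/setP => -[[|[|[|[|[|[|[|//]]]]]]] e7];
    by rewrite inE /f -val_eqE; case: i => [[|[|[|//]]] i3]; rewrite /= inE.
  exists [ffun i => [set e | f e == i]].
    apply: (allocation_of_owner (f := f)) => i; rewrite fE.
    by case: i => [[|[|[|//]]] i3]; apply: connected_block.
  move=> i; rewrite ffunE fE /bundle_value /chores_seven big_mkcond.
  rewrite !big_ord_recl big_ord0 -val_eqE.
  by case: i => [[|[|[|//]]] i3]; rewrite !inE /=; lra.
move=> A alA pA.
pose o0 := @Ordinal 7 0 isT; pose o1 := @Ordinal 7 1 isT; pose o2 := @Ordinal 7 2 isT.
pose o3 := @Ordinal 7 3 isT; pose o4 := @Ordinal 7 4 isT; pose o5 := @Ordinal 7 5 isT.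
pose o6 := @Ordinal 7 6 isT.
have n3 : 3%:R^-1 = 1 / 3 :> R by rewrite div1r.
have [h hA] := allocation_owner o4 alA; have [h0|h0] := eqVneq h ord0; last first.
  exists h; apply: le_trans (bundle_value_le1 h vf hA) _.
  by rewrite /chores_seven (negbTE h0).
subst h; exfalso.
have [i iA] := allocation_owner o2 alA; have [k kA] := allocation_owner o6 alA.
have [j jA] := allocation_owner o0 alA.
have conv l (x y z : 'I_7) : (x <= y <= z)%N -> x \in A l -> z \in A l -> y \in A l.
  exact: connected_convex (allocation_connected l alA).
have i0 : i != ord0.
  apply/eqP => i0; subst i.
  by apply: (prop1_sandwich (y := o3) vf alA pA _ iA hA) => //;
    rewrite n3 /chores_seven/=; lra.
have k0 : k != ord0.
  apply/eqP => k0; subst k.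
  by apply: (prop1_sandwich (y := o5) vf alA pA _ hA kA) => //;
    rewrite n3 /chores_seven/=; lra.
have ik : i != k.
  apply: contra_neq i0 => ik; subst k.
  by apply: (allocation_uniq alA _ hA); apply: conv iA kA.
(* The owner of item 0 is not [k], as item 4 lies between, nor agent 0, as item 2 does; among three
   agents only [i] remains. *)
have ij : j = i.
  have jk : j != k.
    apply: contra_neq k0 => jk; subst k.
    by apply: (allocation_uniq alA _ hA); apply: conv jA kA.
  have j0 : j != ord0.
    apply: contra_neq i0 => j0; subst j.
    by apply: (allocation_uniq alA iA); apply: conv jA hA.
  apply: val_inj; move: i0 k0 ik jk j0; rewrite -!val_eqE /=.
  by have := ltn_ord i; have := ltn_ord j; have := ltn_ord k; lia.
subst j; apply: (prop1_sandwich (y := o1) vf alA pA _ jA iA) => //.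
all: by rewrite n3 /chores_seven (negbTE i0)/=; lra.
Qed.

End LowerBounds.

Theorem theorem22 (R : realType) :
  price_of_prop1 R 3 = 2%:E /\
  (forall n : nat, (4 <= n)%N -> price_of_prop1 R n = (n%:R / 2)%:E).
Proof.
split=> [|n n4]; apply/eqP; rewrite eq_le; apply/andP; split.
- by apply: ge_ereal_sup => _ [m [v [vf ->]]]; apply: price_le => //; lra.
- apply: ereal_le_of_lt => [|r /andP[r1 r2]]; first by lra.
  have r6 : 0 < 6 + 3 * r by lra.
  (* The solution of [(2 / 3 - 2 * d) / (1 / 3 + d) = r]. *)
  pose d := (2 - r) / (6 + 3 * r).
  have d0 : 0 < d by rewrite divr_gt0//; lra.
  have d3 : d < 1 / 3 by rewrite ltr_pdivrMr//; lra.
  have -> : r = (2 / 3 - 2 * d) / (1 / 3 + d).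
    have dr : d * (6 + 3 * r) = 2 - r by rewrite divfK// gt_eqF.
    apply: (canRL (mulfK _)); first by rewrite gt_eqF//; lra.
    by lra.
  apply: le_trans (price_chores_seven d0 d3) _; apply: ereal_sup_ubound.
  by exists 7%N, (chores_seven d); split=> //; apply: chores_seven_fair; lra.
- have n2 : 2 <= n%:R / 2 :> R.
    by rewrite ler_pdivlMr// -natrM ler_nat.
  apply: ge_ereal_sup => _ [m [v [vf ->]]]; apply: price_le => //.
  exact: leq_trans n4.
- case: n n4 => [|[|n]]// n4.
  have n2 : 2 <= n.+2%:R / 2 :> R by rewrite ler_pdivlMr// -natrM ler_nat.
  apply: ereal_le_of_lt => [|r /andP[r1 rn]]; first by apply: lt_le_trans n2; lra.
  have r0 : 0 < r by lra.
  (* The parameter [u = (2 * r)^-1] solves [1 / (2 * u) = r], and exceeds [1/n] because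
     [r < n/2]. *)
  have u1 : (2 * r)^-1 <= 1 by rewrite invf_le1; lra.
  have nu : n.+2%:R^-1 < (2 * r)^-1.
    by rewrite ltf_pV2 ?posrE ?mulr_gt0// mulrC -ltr_pdivlMr.
  have -> : r = 1 / (2 * (2 * r)^-1) by rewrite div1r invfM invrK mulKf.
  apply: le_trans (@price_chores_four R (2 * r)^-1 n _) _; first by rewrite nu u1.
  apply: ereal_sup_ubound; exists 4%N, (@chores_four R (2 * r)^-1 n); split=> //.
  by apply: chores_four_fair; rewrite u1 invr_ge0 mulr_ge0 ?ltW.
Qed.
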